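(* Let $G$ be a threshold graph on $n$ vertices given by a creation sequence. Then all maximum independent sets of $G$ can be counted in time $O(n)$ and enumerated in time $O(\omega(G)\cdot\alpha(G))$.
   Context: A graph $G=(V,E)$ is a threshold graph if it can be built from a single vertex by repeatedly adding an isolated vertex or a dominating vertex. Equivalently, there exist non-negative reals $w_v$ and $T$ such that $U\subseteq V$ is independent if and only if $\sum_{v\in U}w_v\le T$. A creation sequence for $G$ with $|V|=n$ is a binary string $t_1\ldots t_n$ with $t_1=1$, together with a bijection $v:\{1,\ldots,n\}\to V$, such that for $i\ge2$: $t_i=1$ if $v(i)$ is adjacent to all of $v(1),\ldots,v(i-1)$, and $t_i=0$ if $v(i)$ is adjacent to none of them. $\omega(G)$ is the size of a largest clique and $\alpha(G)$ the size of a largest independent set. A maximum independent set is an independent set of size $\alpha(G)$. *)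

(* Defs.v *)
From mathcomp Require Import all_boot.

Set Implicit Arguments.
Unset Strict Implicit.
Unset Printing Implicit Defensive.

Record sgraph (V : finType) := SGraph {
  adj :> rel V;
  adj_sym : symmetric adj;
  adj_irrefl : irreflexive adj }.

Section Graphs.
Variables (V : finType) (G : sgraph V).

Definition clique (K : {set V}) : bool :=
  [forall x in K, forall y in K, (x != y) ==> G x y].

Definition independent (U : {set V}) : bool :=
  [forall x in U, forall y in U, ~~ G x y].

Definition omega : nat := \max_(K : {set V} | clique K) #|K|.

Definition alpha : nat := \max_(U : {set V} | independent U) #|U|.

Definition max_independent_sets : {set {set V}} :=
  [set U : {set V} | independent U && (#|U| == alpha)].

(* [buildable A]: the subgraph induced on A is obtained from a single vertex by
   repeatedly adding an isolated or a dominating vertex. *)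
Inductive buildable : {set V} -> Prop :=
| Build_single x : buildable [set x]
| Build_isolated (A : {set V}) x :
    buildable A -> x \notin A -> (forall y, y \in A -> ~~ G x y) ->
    buildable (x |: A)
| Build_dominating (A : {set V}) x :
    buildable A -> x \notin A -> (forall y, y \in A -> G x y) ->
    buildable (x |: A).

Definition threshold : Prop := buildable [set: V].

(* Indices are shifted: [tnth t i] and [v i] are t_(i+1) and v(i+1).  The first
   clause is t_1 = 1; the default value [false] makes it fail for n = 0. *)
Definition creation_sequence (n : nat) (t : n.-tuple bool) (v : 'I_n -> V)
    : Prop :=
  [/\ nth false t 0 = true,
      bijective v
    & forall i : 'I_n, 0 < i ->
        if tnth t i then forall j : 'I_n, j < i -> G (v i) (v j)
        else forall j : 'I_n, j < i -> ~~ G (v i) (v j)].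

End Graphs.

(* The random access machine of Cook and Reckhow ("Time bounded random access
   machines", 1973) under the uniform cost measure: every executed instruction
   costs one unit.  Registers X_0, X_1, ... hold natural numbers and subtraction
   is truncated. *)

Inductive instr :=
| RConst (i c : nat)    (* X_i := c *)
| RAdd (i j k : nat)    (* X_i := X_j + X_k *)
| RSub (i j k : nat)    (* X_i := X_j - X_k *)
| RFetch (i j : nat)    (* X_i := X_(X_j) *)
| RStore (i j : nat)    (* X_(X_i) := X_j *)
| RJpos (j m : nat)     (* if X_j > 0 then go to instruction m *)
| RRead (i : nat)       (* X_i := next number on the input tape, 0 at its end *)
| RPrint (i : nat).     (* append X_i to the output tape *)

Definition program := seq instr.

Record config := Config {
  pc : nat;
  regs : nat -> nat;
  input : seq nat;
  output : seq nat }.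

Definition upd (r : nat -> nat) (i x : nat) : nat -> nat :=
  fun j => if j == i then x else r j.

Definition exec (a : instr) (c : config) : config :=
  let: Config p r inp out := c in
  match a with
  | RConst i x => Config p.+1 (upd r i x) inp out
  | RAdd i j k => Config p.+1 (upd r i (r j + r k)) inp out
  | RSub i j k => Config p.+1 (upd r i (r j - r k)) inp out
  | RFetch i j => Config p.+1 (upd r i (r (r j))) inp out
  | RStore i j => Config p.+1 (upd r (r i) (r j)) inp out
  | RJpos j m => Config (if 0 < r j then m else p.+1) r inp out
  | RRead i => Config p.+1 (upd r i (head 0 inp)) (behead inp) out
  | RPrint i => Config p.+1 r inp (rcons out (r i))
  end.

(* The machine halts when the program counter leaves the program. *)
Definition step (P : program) (c : config) : config :=
  if onth P (pc c) is Some a then exec a c else c.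

Definition halted (P : program) (c : config) : bool := size P <= pc c.

Definition start (inp : seq nat) : config := Config 0 (fun=> 0) inp [::].

(* On input [inp], the program P halts after at most T instructions and the
   numbers it has printed are exactly [out]. *)
Definition outputs_within (P : program) (inp : seq nat) (T : nat)
    (out : seq nat) : Prop :=
  exists k : nat, let c := iter k (step P) (start inp) in
    [/\ k <= T, halted P c & output c = out].

(* A vertex is represented by its number in the enumeration of V. *)
Definition label (V : finType) (x : V) : nat := enum_rank x.

(* The tape n, t_1, ..., t_n, v(1), ..., v(n). *)
Definition encode_creation (V : finType) (n : nat) (t : n.-tuple bool)
    (v : 'I_n -> V) : seq nat :=
  n :: [seq nat_of_bool b | b <- t] ++ [seq label (v i) | i <- enum 'I_n].

Definition encode_vertices (V : finType) (s : seq V) : seq nat :=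
  size s :: [seq label x | x <- s].

(* [out] lists every member of F exactly once, in some order; a set is written
   as its cardinality followed by its vertices, without repetition, in some
   order. *)
Definition enumerates (V : finType) (F : {set {set V}}) (out : seq nat)
    : Prop :=
  exists L : seq (seq V),
    [/\ all uniq L,
        perm_eq [seq [set x in s] | s <- L] (enum F)
      & out = flatten [seq encode_vertices s | s <- L]].

(* Main.v *)
(** For a creation sequence starting with [p] ones and containing [z] zeros, an
independent set contains at most one vertex added as a dominating one, and such
a vertex excludes every earlier vertex.  Hence the maximum independent sets are
exactly the [p] sets consisting of the [z] isolated vertices and one vertex of
the initial run of ones; [alpha] is [z + 1], [omega] is at least the number of
ones, and so [n <= omega * alpha].  Counting amounts to measuring the initial
run; for the enumeration, the machine first packs the labels of the initial run
and of the isolated vertices into consecutive registers, in linear time, and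
then writes each set by scanning the packed isolated vertices. *)

Require Import Defs.
From mathcomp Require Import all_boot zify.

Set Implicit Arguments.
Unset Strict Implicit.
Unset Printing Implicit Defensive.

(** * Time-bounded runs of the machine *)

Section RunsTo.
Variable P : program.

(** [T] is only an upper bound, so branches of different lengths share one estimate; halting is left
    to [Q], so consecutive code segments compose and their bounds add. *)
Definition runs_to (T : nat) (c : config) (Q : config -> Prop) : Prop :=
  exists2 k, k <= T & Q (iter k (step P) c).

Lemma runs_to_refl T c (Q : config -> Prop) : Q c -> runs_to T c Q.
Proof. by exists 0. Qed.

Lemma runs_to_step T c Q : runs_to T (step P c) Q -> runs_to T.+1 c Q.
Proof. by case=> k lekT Qk; exists k.+1; rewrite // iterSr. Qed.

Lemma runs_to_seq T1 T2 c (Q1 Q2 : config -> Prop) :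
  runs_to T1 c Q1 -> (forall c', Q1 c' -> runs_to T2 c' Q2) ->
  runs_to (T1 + T2) c Q2.
Proof.
case=> k1 le1 Qk1 /(_ _ Qk1)[k2 le2 Qk2]; exists (k2 + k1); last by rewrite iterD.
by rewrite addnC leq_add.
Qed.

Lemma runs_to_post T c (Q1 Q2 : config -> Prop) :
  runs_to T c Q1 -> (forall c', Q1 c' -> Q2 c') -> runs_to T c Q2.
Proof. by move=> [k lekT Qk] Q12; exists k => //; apply: Q12. Qed.

Lemma runs_to_leq T1 T2 c Q : T1 <= T2 -> runs_to T1 c Q -> runs_to T2 c Q.
Proof. by move=> le12 [k lek1 Qk]; exists k; rewrite // (leq_trans lek1). Qed.

Lemma outputs_within_runs_to T inp out :
  runs_to T (start inp) (fun c => halted P c /\ output c = out) ->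
  outputs_within P inp T out.
Proof. by case=> k lekT [hP oP]; exists k. Qed.

End RunsTo.

(** * Register updates and blocks of consecutive registers *)

Lemma updE r i x j : upd r i x j = if j == i then x else r j.
Proof. by []. Qed.

Lemma upd_neq r i x j : j != i -> upd r i x j = r j.
Proof. by rewrite updE => /negbTE ->. Qed.

Definition block (r : nat -> nat) (a m : nat) : seq nat :=
  [seq r j | j <- iota a m].

Lemma eq_block r r' a m :
  (forall j, a <= j < a + m -> r j = r' j) -> block r a m = block r' a m.
Proof. by move=> rr'; apply/eq_in_map => j; rewrite mem_iota => /rr'. Qed.

Lemma blockS r a m : block r a m.+1 = r a :: block r a.+1 m.
Proof. by []. Qed.

Lemma blockD r a m1 m2 : block r a (m1 + m2) = block r a m1 ++ block r (a + m1) m2.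
Proof. by rewrite /block iotaD map_cat. Qed.

Lemma size_block r a m : size (block r a m) = m.
Proof. by rewrite size_map size_iota. Qed.

Ltac exec_step := apply: runs_to_step; rewrite /step /= ?updE /=.

(** * The counting program and its linear running time *)

Definition count_program : program :=
  [:: RRead 0;
      RConst 1 1;
      RJpos 1 8;
      RRead 2;
      RJpos 2 6;
      RJpos 1 9;
      RAdd 3 3 1;
      RSub 0 0 1;
      RJpos 0 3;
      RPrint 3].

(** Loop invariant at the test: [X_0] counts the bits left and [X_3] the ones met so far. The loop
    ends at the first zero or when the bits run out, which is exactly where [find negb] stops. *)
Lemma count_loop (bs : seq bool) inp r :
  r 0 = size bs -> r 1 = 1 ->
  runs_to count_program (6 * size bs + 2)
    (Config 8 r ([seq nat_of_bool b | b <- bs] ++ inp) [::])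
    (fun c => halted count_program c /\ output c = [:: r 3 + find negb bs]).
Proof.
elim: bs r => [|b bs IHbs] r r0 r1.
  exec_step; rewrite r0; exec_step.
  by apply: runs_to_refl; rewrite addn0.
apply: (@runs_to_leq _ (5 + (6 * size bs + 2))); first by move=> /=; lia.
exec_step; rewrite r0 /=; exec_step; exec_step.
case: b {r0}(r0) => r0 /=; exec_step; last first.
  by rewrite r1; exec_step; apply: runs_to_refl; rewrite addn0.
exec_step; apply: runs_to_post (IHbs _ _ _) _; rewrite /= ?updE /= ?r0 ?r1 ?subn1 //.
by rewrite addn1 addSnnS.
Qed.

Lemma count_programP n (bs : seq bool) inp : size bs = n ->
  runs_to count_program (6 * n + 5)
    (start (n :: [seq nat_of_bool b | b <- bs] ++ inp))
    (fun c => halted count_program c /\ output c = [:: find negb bs]).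
Proof.
move=> szbs; rewrite [6 * n + 5](_ : _ = 3 + (6 * n + 2)); last by lia.
rewrite /start; do 3 exec_step; rewrite -szbs.
exact: runs_to_post (count_loop _ _ _) _.
Qed.

(** * The enumeration program and its running time *)

(* X_1 is the constant 1 and the data start at X_9.  Instructions 0-15 store one
   flag per vertex, set for the vertices of the initial run and the isolated
   ones, and leave in X_5 the address following the initial run; 16-25 overwrite
   the flags by the labels of the flagged vertices, which is safe as the write
   address X_7 never exceeds the read address X_6; 26-42 print the sets. *)
Definition enum_program : program :=
  [:: RRead 0;
      RConst 1 1;
      RConst 2 9;
      RConst 4 1;
      RConst 5 9;
      RJpos 1 15;
      RRead 3;
      RJpos 3 11;
      RConst 4 0;
      RStore 2 1;
      RJpos 1 13;
      RStore 2 4;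
      RAdd 5 5 4;
      RAdd 2 2 1;
      RSub 0 0 1;
      RJpos 0 6;
      RConst 6 9;
      RConst 7 9;
      RJpos 1 24;
      RRead 3;
      RFetch 8 6;
      RStore 7 3;
      RAdd 7 7 8;
      RAdd 6 6 1;
      RSub 3 2 6;
      RJpos 3 19;
      RSub 4 7 5;
      RAdd 4 4 1;
      RConst 6 9;
      RJpos 1 41;
      RPrint 4;
      RFetch 3 6;
      RPrint 3;
      RAdd 2 5 0;
      RJpos 1 38;
      RFetch 3 2;
      RPrint 3;
      RAdd 2 2 1;
      RSub 3 7 2;
      RJpos 3 35;
      RAdd 6 6 1;
      RSub 3 5 6;
      RJpos 3 30].

(* [q] tells whether only ones have been met so far. *)
Fixpoint run_flags (q : bool) (bs : seq bool) : seq bool :=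
  if bs is b :: bs' then
    if b then q :: run_flags q bs' else true :: run_flags false bs'
  else [::].

Lemma size_run_flags q bs : size (run_flags q bs) = size bs.
Proof. by elim: bs q => [|[] bs IHbs] q //=; rewrite IHbs. Qed.

Lemma run_flags_false bs : run_flags false bs = map negb bs.
Proof. by elim: bs => [|[] bs IHbs] //=; rewrite IHbs. Qed.

(** From the first zero on, the flags are the negated bits, and the negated bits drop the whole
    initial run. So compaction yields two adjacent blocks. *)
Lemma mask_run_flags (T : Type) bs (s : seq T) :
  mask (run_flags true bs) s = take (find negb bs) s ++ mask (map negb bs) s.
Proof.
elim: bs s => [|b bs IHbs] [|x s] //=.
  by rewrite !mask0.
by case: b => /=; rewrite ?IHbs ?run_flags_false.
Qed.

(** [X_4] holds [q] as a number: at a one it is both the flag stored and the increment of [X_5]. The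
    clause on cells below [a] ensures that a flag just written survives the later iterations. *)
Lemma flag_loop (bs : seq bool) inp out r (q : bool) a :
  r 0 = size bs -> r 1 = 1 -> r 2 = a -> 9 <= a -> r 4 = q ->
  runs_to enum_program (9 * size bs + 1)
    (Config 15 r ([seq nat_of_bool b | b <- bs] ++ inp) out)
    (fun c => exists2 r', c = Config 16 r' inp out &
      [/\ [/\ r' 0 = 0, r' 1 = 1 & r' 2 = a + size bs],
          r' 5 = r 5 + (if q then find negb bs else 0),
          block r' a (size bs) = [seq nat_of_bool b | b <- run_flags q bs]
        & forall j, 9 <= j < a -> r' j = r j]).
Proof.
elim: bs r q a => [|b bs IHbs] r q a r0 r1 r2 le9a r4.
  exec_step; rewrite r0; apply: runs_to_refl; exists r => //.
  by split; [split; rewrite ?addn0 | rewrite if_same addn0 | |].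
have neq_a j : j < 9 -> ((j == a) = false) * ((a == j) = false).
  by move=> ltj9; split; lia.
apply: (@runs_to_leq _ (8 + (9 * size bs + 1))); first by move=> /=; lia.
exec_step; rewrite r0 /=; exec_step; exec_step.
case: b {r0}(r0) => r0 /=.
  do 4 (exec_step; rewrite ?r2 ?neq_a //=).
  apply: runs_to_leq (leqnSn _) _; apply: runs_to_post (IHbs _ q a.+1 _ _ _ (leqW le9a) _) _;
    rewrite /= ?updE /= ?updE /= ?neq_a ?r0 ?r1 ?subn1 ?addn1 //.
  move=> _ [r' -> [[r'0 r'1 r'2] r'5 blk old]]; exists r' => //; split.
  - by split; rewrite // addnS.
  - by rewrite r'5 r4; case: (q); rewrite /= ?addn0 // addn1 addSnnS.
  - by rewrite blockS -blk old ?le9a ?leqnn // !updE eqxx !neq_a // r4.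
  - by move=> j ltj; rewrite old ?[_ < a.+1]ltnS; [rewrite !upd_neq | ]; lia.
do 5 (exec_step; rewrite ?r1 ?r2 ?neq_a //=).
apply: runs_to_post (IHbs _ false a.+1 _ _ _ (leqW le9a) _) _;
  rewrite /= ?updE /= ?updE /= ?neq_a ?r0 ?r1 ?subn1 ?addn1 //.
move=> _ [r' -> [[r'0 r'1 r'2] r'5 blk old]]; exists r' => //; split.
- by split; rewrite // addnS.
- by rewrite r'5 if_same.
- by rewrite blockS -blk old ?le9a ?leqnn // !updE eqxx !neq_a // r1.
- by move=> j ltj; rewrite old; [rewrite !upd_neq | ]; lia.
Qed.

(** Each label is stored at [w] unconditionally, after its flag has been fetched, and [w] then grows
    by that flag; thus an unflagged label is never kept. *)
Lemma compact_loop (fs : seq bool) ls inp out r i w :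
  size fs = size ls -> r 1 = 1 -> r 2 = i + size ls -> r 6 = i -> r 7 = w ->
  9 <= w <= i -> block r i (size ls) = [seq nat_of_bool b | b <- fs] ->
  runs_to enum_program (7 * size ls + 2)
    (Config 24 r (ls ++ inp) out)
    (fun c => exists2 r', c = Config 26 r' inp out &
      [/\ [/\ r' 0 = r 0, r' 1 = 1 & r' 5 = r 5],
          r' 7 = w + size (mask fs ls),
          block r' w (size (mask fs ls)) = mask fs ls
        & forall j, 9 <= j < w -> r' j = r j]).
Proof.
elim: ls fs r i w => [|x ls IHls] [|f fs] // r i w sz r1 r2 r6 r7 lew blk.
  do 2 (exec_step; rewrite ?r2 ?r6 ?addn0 ?subnn); apply: runs_to_refl.
  exists (upd r 3 0) => //; split; rewrite ?addn0 //.
  by move=> j ltj; rewrite upd_neq //; lia.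
have neq_w j : j < 9 -> ((j == w) = false) * ((w == j) = false).
  by move=> ltj9; split; lia.
apply: (@runs_to_leq _ (7 + (7 * size ls + 2))); first by move=> /=; lia.
case: sz blk => sz [ri blk].
have neq_i j : j < 9 -> (i == j) = false by move=> ltj9; lia.
do 2 (exec_step; rewrite ?r2 ?r6 /= ?addKn //=).
do 5 (exec_step; rewrite ?r1 ?r2 ?r6 ?r7 ?updE ?neq_w ?neq_i ?ri ?addn1 //=).
apply: runs_to_post (IHls fs _ i.+1 (w + f) _ _ _ _ _ _ _) _;
  rewrite /= ?updE /= ?neq_w ?r2 ?addSnnS //.
- by case: f {ri}; lia.
(* The store went to [w <= i], so the unread flags, from [i.+1] on, are intact. *)
- rewrite -blk; apply: eq_block => j ltj; rewrite !upd_neq //; lia.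
move=> _ [r' -> [[r'0 r'1 r'5] r'7 blk' old]]; exists r' => //; split.
- by split.
- by rewrite r'7; case: (f) => /=; rewrite ?addn0 // addn1 addSnnS.
- case: f {ri r'7} blk' old => /=; rewrite ?addn0 // addn1 => blk' old.
  by rewrite blockS blk' old ?updE ?eqxx ?neq_w //; lia.
- by move=> j ltj; rewrite old; [rewrite !upd_neq | ]; lia.
Qed.

(** Only the scratch registers [X_2] and [X_3] change, which preserves the invariant of the outer
    loop; [9 <= r 2] keeps the printed block clear of them. *)
Lemma print_loop m inp out r :
  r 1 = 1 -> r 7 = r 2 + m -> 9 <= r 2 ->
  runs_to enum_program (5 * m + 2) (Config 38 r inp out)
    (fun c => exists2 r', c = Config 40 r' inp (out ++ block r (r 2) m) &
      forall j, j != 2 -> j != 3 -> r' j = r j).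
Proof.
elim: m r out => [|m IHm] r out r1 r7 le9.
  do 2 (exec_step; rewrite ?r7 ?addn0 ?subnn); apply: runs_to_refl.
  by exists (upd r 3 0); rewrite ?cats0 // => j _ j3; rewrite upd_neq.
apply: (@runs_to_leq _ (5 + (5 * m + 2))); first by move=> /=; lia.
do 2 (exec_step; rewrite ?r7 ?addKn /=).
have neq3 : (r 2 == 3) = false by lia.
do 3 (exec_step; rewrite ?neq3 ?r1 ?addn1).
apply: runs_to_post (IHm _ _ _ _ (leqW le9)) _; rewrite /= ?updE /= ?r7 ?addSnnS //.
move=> _ [r' -> old]; exists r'; last first.
  by move=> j j2 j3; rewrite old // !upd_neq.
congr Config; rewrite -cats1 -catA /=; congr (_ ++ _ :: _).
by apply: eq_block => j ltj; rewrite !upd_neq //; lia.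
Qed.

(** [X_4] is the cardinality printed before each set; [X_0 = 0] turns the addition into [X_2] into a
    copy of [X_5]. *)
Lemma enum_loop m z inp out r :
  r 0 = 0 -> r 1 = 1 -> r 4 = z.+1 -> r 5 = r 6 + m -> r 7 = r 5 + z -> 9 <= r 6 ->
  runs_to enum_program (m * (5 * z + 10) + 2) (Config 41 r inp out)
    (fun c => exists r', c = Config 43 r' inp
      (out ++ flatten [seq z.+1 :: x :: block r (r 5) z | x <- block r (r 6) m])).
Proof.
elim: m r out => [|m IHm] r out r0 r1 r4 r5 r7 le9.
  do 2 (exec_step; rewrite ?r5 ?addn0 ?subnn); apply: runs_to_refl.
  by exists (upd r 3 0); rewrite cats0.
(* Seven instructions lead to the inner loop, one advances [X_6] after it. *)
apply: (@runs_to_leq _ (7 + ((5 * z + 2) + (1 + (m * (5 * z + 10) + 2))))).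
  by rewrite mulSn; lia.
have neq3 : (r 6 == 3) = false by lia.
do 2 (exec_step; rewrite ?r5 ?addKn /=).
do 5 (exec_step; rewrite ?neq3 ?r0 ?r1 ?addn0).
apply: runs_to_seq (print_loop _ _ _ _ _) _; rewrite /= ?updE //=.
  by rewrite r5; lia.
move=> _ [r' -> old]; exec_step.
have old' j : 4 <= j -> r' j = r j by move=> lej; rewrite old ?upd_neq //; lia.
apply: runs_to_post (IHm _ _ _ _ _ _ _ _) _;
  rewrite /= ?updE /= ?(old 0) ?(old 1) ?old' ?updE //= ?r1 ?addn1 ?r5 ?addSnnS //.
- exact: leqW.
have eb a k : 9 <= a -> block (upd r' 6 (r 6).+1) a k = block r a k.
  by move=> lea; apply: eq_block => j ltj; rewrite upd_neq ?old' //; lia.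
move=> _ [r'' ->]; exists r''; congr Config; rewrite -!cats1 -!catA /=.
congr (_ ++ _); rewrite r4 !eb ?leqW //; last by lia.
congr (_ :: _ :: _ ++ _).
by apply: eq_block => j ltj; rewrite !upd_neq //; lia.
Qed.

Lemma enum_programP n (bs : seq bool) (ls : seq nat) :
  size bs = n -> size ls = n ->
  let zs := mask (map negb bs) ls in
  runs_to enum_program (16 * n + 18 + find negb bs * (5 * size zs + 10))
    (start (n :: [seq nat_of_bool b | b <- bs] ++ ls))
    (fun c => halted enum_program c /\
      output c = flatten [seq (size zs).+1 :: x :: zs | x <- take (find negb bs) ls]).
Proof.
move=> szb szl zs; set p := find negb bs.
have lepn : p <= n by rewrite -szb find_size.
have szf : size (run_flags true bs) = size ls by rewrite size_run_flags szl.
(* The summands 6, 3 and 4 count the initializations before the three loops, each including the jump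
   to the loop test. *)
apply: (@runs_to_leq _ (6 + ((9 * size bs + 1) + (3 + ((7 * size ls + 2) +
          (4 + (p * (5 * size zs + 10) + 2))))))); first by rewrite szb szl; lia.
rewrite /start; do 6 exec_step.
apply: runs_to_seq (flag_loop (q := true) (a := 9) _ _ _ _ _ _ _) _ => //.
move=> _ [r -> [[r0 r1 r2] r5 blk _]].
do 3 (exec_step; rewrite ?r1).
rewrite -[ls in Config _ _ ls _]cats0.
apply: runs_to_seq (compact_loop (fs := run_flags true bs) (i := 9) (w := 9)
    _ _ _ _ _ _ _ _ _) _; rewrite /= ?updE //=.
- by rewrite r2 szb szl.
- by rewrite -blk szl -szb; apply: eq_block => j ltj; rewrite !upd_neq //; lia.
move=> _ [r' -> [[r'0 r'1 r'5] r'7 blk' _]].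
rewrite r5 updE /= -/p in r'5.
rewrite mask_run_flags size_cat size_takel ?szl // -/p -/zs in r'7 blk'.
have [blk1 blk2] : block r' 9 p = take p ls /\ block r' (9 + p) (size zs) = zs.
  move/eqP: blk'; rewrite blockD eqseq_cat ?size_block ?size_takel ?szl //.
  by case/andP=> /eqP -> /eqP ->.
do 4 (exec_step; rewrite ?r'1).
apply: runs_to_post (enum_loop (m := p) (z := size zs) _ _ _ _ _ _ _ _) _;
  rewrite /= ?updE //= ?r'5 ?r'7; try lia.
move=> _ [r'' ->]; split=> //=.
have eb x y a k : 9 <= a -> block (upd (upd (upd r' 4 x) 4 y) 6 9) a k = block r' a k.
  by move=> lea; apply: eq_block => j ltj; rewrite !upd_neq //; lia.
by rewrite !eb // blk1 blk2.
Qed.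

Lemma find_negb_le_count (bs : seq bool) : find negb bs <= count id bs.
Proof. by elim: bs => [|[] bs IHbs]. Qed.

(** * Maximum independent sets read off from a creation sequence *)

Section MaxIndependentSets.
Variables (V : finType) (G : sgraph V) (n : nat) (t : n.-tuple bool).
Variable v : 'I_n -> V.
Hypothesis Gtv : creation_sequence G t v.

Let vs := [seq v i | i <- enum 'I_n].

Definition initial_run : seq V := take (find negb t) vs.
Definition isolated_vertices : seq V := mask (map negb t) vs.

Lemma independentP (U : {set V}) :
  reflect {in U &, forall x y, ~~ G x y} (independent G U).
Proof.
apply: (iffP forall_inP) => [indU x y xU yU|indU x xU].
  by move/forall_inP: (indU x xU); apply.
by apply/forall_inP => y; apply: indU.
Qed.

Lemma creation_inj : injective v.
Proof. by case: Gtv => _ /bij_inj. Qed.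

Lemma creation_surj x : exists i, x = v i.
Proof. by case: Gtv => _ [w _ vK] _; exists (w x). Qed.

(** [j < i] forces [0 < i], so the clause for [i] applies: the bit of the later vertex decides
    adjacency. *)
Lemma creation_adj (i j : 'I_n) : j < i -> G (v i) (v j) = tnth t i.
Proof.
case: Gtv => _ _ /(_ i) Gi ltji; have /Gi := leq_ltn_trans (leq0n j) ltji.
by case: (tnth t i) => /(_ j ltji) => [|/negbTE].
Qed.

Lemma creation_size_gt0 : 0 < n.
Proof. by case: Gtv => t0 _ _; rewrite -(size_tuple t); case: (tval t) t0. Qed.

Lemma creation_uniq : uniq vs.
Proof. by rewrite map_inj_uniq ?enum_uniq //; apply: creation_inj. Qed.

(** General in [f]: [negb] selects the isolated vertices, [id] the dominating ones. *)
Lemma mem_mask_creation (f : bool -> bool) i :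
  (v i \in mask (map f t) vs) = f (tnth t i).
Proof.
rewrite -(map_tnth_enum t) -map_comp /vs -map_mask -filter_mask.
by rewrite (mem_map creation_inj) mem_filter mem_enum andbT.
Qed.

Lemma mem_initial_run i : (v i \in initial_run) = (i < find negb t).
Proof.
rewrite /initial_run /vs -map_take (mem_map creation_inj).
by rewrite in_take ?mem_enum // index_enum_ord.
Qed.

Lemma size_isolated : size isolated_vertices = count negb t.
Proof.
by rewrite size_mask ?count_map // size_map size_tuple size_map size_enum_ord.
Qed.

Lemma size_initial_run : size initial_run = find negb t.
Proof.
rewrite size_takel // size_map size_enum_ord -[X in _ <= X](size_tuple t).
exact: find_size.
Qed.

Lemma initial_run_bit (i : 'I_n) : i < find negb t -> tnth t i.
Proof. by move/(before_find false)/negbFE; rewrite -tnth_nth. Qed.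

Lemma in_initial_run (i : 'I_n) :
  (forall j : 'I_n, j < i -> tnth t j) -> tnth t i -> i < find negb t.
Proof.
move=> ti tti; rewrite ltnNge; apply/negP => lepi.
have ltpn := leq_ltn_trans lepi (ltn_ord i).
have/(nth_find false): has negb t by rewrite has_find size_tuple.
rewrite -(tnth_nth false t (Ordinal ltpn)).
move: lepi; rewrite leq_eqVlt => /predU1P [pi|/(ti (Ordinal ltpn)) -> //].
by rewrite (_ : Ordinal ltpn = i) ?tti //; apply: val_inj.
Qed.

Lemma uniq_run_isolated x : x \in initial_run -> uniq (x :: isolated_vertices).
Proof.
have [i ->] := creation_surj x; rewrite mem_initial_run /= => /initial_run_bit ti.
by rewrite mask_uniq ?creation_uniq // mem_mask_creation ti.
Qed.

(** The later of two vertices decides. If it is [v i], the earlier one has bit one and is not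
    isolated, so it is not in the set. *)
Lemma independent_run_isolated x :
  x \in initial_run -> independent G [set y in x :: isolated_vertices].
Proof.
have [i ->] := creation_surj x; rewrite mem_initial_run => ltip.
have nadj (a b : 'I_n) : b < a -> (v a \in v i :: isolated_vertices) ->
    (v b \in v i :: isolated_vertices) -> ~~ G (v a) (v b).
  move=> ltba; rewrite creation_adj // !inE !mem_mask_creation !(inj_eq creation_inj).
  case/predU1P => // ai; rewrite {}ai in ltba *.
  case/predU1P => [eb|]; first by rewrite eb ltnn in ltba.
  by rewrite (initial_run_bit (ltn_trans ltba ltip)).
apply/independentP => y z; rewrite !in_set => yU.
have [a ya] := creation_surj y; have [b ->] := creation_surj z.
rewrite ya in yU * => zU; case: (ltngtP a b) => [lt|lt|/val_inj ->].
- by rewrite adj_sym nadj.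
- exact: nadj.
- by rewrite adj_irrefl.
Qed.

(** If [U] contains [v i] with bit one, every earlier vertex is adjacent to [v i], and a later one
    must have bit zero. With no such vertex, [U] consists of isolated vertices. *)
Lemma independent_shape U : independent G U ->
  (#|U| <= count negb t) \/
  (exists2 i, tnth t i & (v i \in U) && (U \subset v i :: isolated_vertices)).
Proof.
move=> /independentP indU.
case: (pickP [pred i | tnth t i & v i \in U]) => [i /andP[ti viU]|noU].
  right; exists i => //; rewrite viU; apply/subsetP => x.
  have [j ->] := creation_surj x; rewrite inE mem_mask_creation => vjU.
  rewrite (inj_eq creation_inj).
  case: (ltngtP i j) => [lt|lt|/val_inj -> //]; last by rewrite eqxx.
  - have := indU _ _ vjU viU; rewrite creation_adj // => ->; exact: orbT.
  - by have := indU _ _ viU vjU; rewrite creation_adj // ti.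
left; rewrite -size_isolated; apply: leq_trans (card_size _).
apply/subset_leq_card/subsetP => x; have [i ->] := creation_surj x => viU.
by have /= := noU i; rewrite viU andbT mem_mask_creation => ->.
Qed.

Lemma independent_card_le U : independent G U -> #|U| <= (count negb t).+1.
Proof.
case/independent_shape => [/leqW //|[i _ /andP[_ /subset_leq_card leU]]].
by rewrite -size_isolated; apply: leq_trans leU (card_size _).
Qed.

Lemma card_run_isolated x : x \in initial_run ->
  #|[set y in x :: isolated_vertices]| = (count negb t).+1.
Proof.
move=> /uniq_run_isolated /card_uniqP /= xs.
by rewrite -size_isolated -xs; apply: eq_card => y; rewrite inE.
Qed.

Lemma alphaE : alpha G = (count negb t).+1.
Proof.
apply/eqP; rewrite eqn_leq; apply/andP; split.
  by apply/bigmax_leqP => U; apply: independent_card_le.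
(* The first bit is one, so some set attains the bound. *)
have: 0 < size initial_run.
  by rewrite size_initial_run; case: Gtv; case: (tval t) => [|[]].
case E: initial_run => [|x s] // _.
have xr : x \in initial_run by rewrite E mem_head.
by rewrite -(card_run_isolated xr) leq_bigmax_cond ?independent_run_isolated.
Qed.

Lemma max_independent_setsP U :
  reflect (exists2 x, x \in initial_run & U = [set y in x :: isolated_vertices])
          (U \in max_independent_sets G).
Proof.
rewrite inE alphaE; apply: (iffP andP) => [[indU /eqP cardU]|[x xr ->]]; last first.
  by rewrite independent_run_isolated ?card_run_isolated.
have [|[i ti /andP[viU sU]]] := independent_shape indU; first by rewrite cardU ltnn.
(* Maximality of the cardinality turns the inclusion into an equality. *)
have UE : U = [set y in v i :: isolated_vertices].
  apply/eqP; rewrite eqEcard cardU -size_isolated; apply/andP; split.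
    by apply/subsetP => y /(subsetP sU); rewrite [in X in _ -> X]inE.
  by rewrite cardsE; apply: card_size.
exists (v i) => //; rewrite mem_initial_run; apply: in_initial_run => // j ltji.
(* A zero at [j < i] would put [v j] into [U], although [v i] dominates it. *)
apply: contraLR isT => tj.
have vjU : v j \in U by rewrite UE !inE mem_mask_creation tj orbT.
move/independentP: indU => /(_ _ _ viU vjU).
by rewrite creation_adj // ti.
Qed.

Lemma max_independent_sets_enum :
  perm_eq [seq [set y in x :: isolated_vertices] | x <- initial_run]
          (enum (max_independent_sets G)).
Proof.
apply: uniq_perm => [||U]; rewrite ?enum_uniq //.
  (* Testing membership of [x] separates the sets, as [x] is not isolated. *)
  rewrite map_inj_in_uniq ?take_uniq ?creation_uniq // => x y xr yr /setP/(_ x).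
  rewrite !inE eqxx /=; have /andP[/negbTE -> _] := uniq_run_isolated xr.
  by rewrite orbF => /esym/eqP.
rewrite mem_enum; apply/mapP/max_independent_setsP => -[x xr ->]; by exists x.
Qed.

Lemma card_max_independent_sets :
  #|max_independent_sets G| = find negb t.
Proof.
by rewrite cardE -(perm_size max_independent_sets_enum) size_map size_initial_run.
Qed.

(** The vertices with bit one form a clique: the later of any two dominates the earlier. *)
Lemma count_dominating_le_omega : count id t <= omega G.
Proof.
have sz : size (mask t vs) = count id t.
  by rewrite size_mask // size_tuple size_map size_enum_ord.
have uq : uniq (mask t vs) by rewrite mask_uniq ?creation_uniq.
rewrite -sz -(card_uniqP uq) -cardsE; apply: leq_bigmax_cond.
have memE i : (v i \in [set x in mask t vs]) = tnth t i.
  by rewrite inE -[in mask _ _](map_id t) mem_mask_creation.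
apply/forall_inP => x; have [i ->] := creation_surj x; rewrite memE => ti.
apply/forall_inP => y; have [j ->] := creation_surj y; rewrite memE => tj.
apply/implyP; rewrite (inj_eq creation_inj).
case: (ltngtP i j) => [lt|lt|/val_inj ->]; last by rewrite eqxx.
- by rewrite adj_sym creation_adj.
- by rewrite creation_adj.
Qed.

(** With [d >= 1] ones and [z] zeros, [d + z <= d * (z + 1)]. This absorbs the linear preprocessing
    into the product bound. *)
Lemma size_le_omega_alpha : n <= omega G * alpha G.
Proof.
have := count_dominating_le_omega; rewrite alphaE.
have: 0 < count id t by case: Gtv; case: (tval t) => [|[]].
have: count id t + count negb t = n by rewrite -[RHS](size_tuple t) -(count_predC id).
nia.
Qed.

End MaxIndependentSets.

Theorem theorem3p31 :
  (exists (P : program) (C : nat),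
     forall (V : finType) (G : sgraph V) (n : nat)
            (t : n.-tuple bool) (v : 'I_n -> V),
       threshold G -> #|V| = n -> creation_sequence G t v ->
       outputs_within P (encode_creation t v) (C * n)
         [:: #|max_independent_sets G|])
  /\
  (exists (P : program) (C : nat),
     forall (V : finType) (G : sgraph V) (n : nat)
            (t : n.-tuple bool) (v : 'I_n -> V),
       threshold G -> #|V| = n -> creation_sequence G t v ->
       exists out : seq nat,
         outputs_within P (encode_creation t v) (C * (omega G * alpha G)) out
         /\ enumerates (max_independent_sets G) out).
Proof.
split.
  (* [6 * n + 5 <= 11 * n] because [n >= 1]. *)
  exists count_program, 11 => V G n t v _ _ Gtv; apply: outputs_within_runs_to.
  rewrite (card_max_independent_sets Gtv).
  have n_gt0 := creation_size_gt0 Gtv.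
  apply: runs_to_leq (count_programP _ (size_tuple t)); lia.
(* 44 = 16 + 18 + 10: [16 * n + 18 <= 34 * n] with [n] at most the product, and
   [5 * z + 10 <= 10 * (z + 1)] for each of the at most [omega G] sets. *)
exists enum_program, 44 => V G n t v _ _ Gtv.
pose zs := isolated_vertices t v.
pose L := [seq x :: zs | x <- initial_run t v].
exists (flatten [seq encode_vertices s | s <- L]); split; last first.
  exists L; split => //; last by rewrite -map_comp; apply: max_independent_sets_enum.
  by apply/allP => _ /mapP[x xr ->]; apply: uniq_run_isolated Gtv _ xr.
apply: outputs_within_runs_to.
have szl : size [seq label (v i) | i <- enum 'I_n] = n.
  by rewrite size_map size_enum_ord.
have zsE : mask (map negb t) [seq label (v i) | i <- enum 'I_n] = map (@label V) zs.
  by rewrite map_mask -map_comp.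
have := enum_programP (size_tuple t) szl; cbv zeta; rewrite zsE size_map.
rewrite [take _ _](_ : _ = map (@label V) (initial_run t v)); last first.
  by rewrite /initial_run map_take -map_comp.
rewrite -/(encode_creation t v) /L -!map_comp; apply: runs_to_leq.
have := size_le_omega_alpha Gtv; have := count_dominating_le_omega Gtv.
have := find_negb_le_count t; have := creation_size_gt0 Gtv.
rewrite (alphaE Gtv) size_isolated; nia.
Qed.
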